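(* Let $k \ge 2$ be an integer. Then, in every red/blue edge-coloring of the complete graph on the vertex set $V = \binom{[2k+1]}{k}$, there is a monochromatic non-intersecting triangle, that is, there are three distinct sets $A,B,C \in V$ with $A \cap B \cap C = \emptyset$ such that the edges $AB$, $AC$, $BC$ all have the same color.
   Context: For a positive integer $n$, $[n] = \{1,\dots,n\}$, and $\binom{[n]}{k}$ denotes the family of all $k$-element subsets of $[n]$. The complete graph on $V$ has an edge between every two distinct elements of $V$ (distinct $k$-sets, whether or not they are disjoint). A red/blue edge-coloring assigns to each edge exactly one of the colors red or blue. A triangle $ABC$ (three distinct vertices $A,B,C\in V$) is called non-intersecting if $A \cap B \cap C = \emptyset$, and monochromatic if its three edges have the same color. *)

(* Defs.v *)
From mathcomp Require Import all_boot.

Set Implicit Arguments.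
Unset Strict Implicit.
Unset Printing Implicit Defensive.

(* The ground set [n] = {1, ..., n} is represented by 'I_n = {0, ..., n-1}. *)
Definition ksubset (n k : nat) := {A : {set 'I_n} | #|A| == k}.

Definition edge (V : finType) := {e : {set V} | #|e| == 2}.

Lemma card_edge (V : finType) (x y : V) : x != y -> #|[set x; y]| == 2.
Proof. by move=> neq_xy; rewrite cards2 neq_xy. Qed.

Definition edge_of (V : finType) (x y : V) (neq_xy : x != y) : edge V :=
  exist _ [set x; y] (card_edge neq_xy).

Inductive color := Red | Blue.

Definition coloring (V : finType) := edge V -> color.

Definition nonintersecting (n k : nat) (A B C : ksubset n k) : Prop :=
  val A :&: val B :&: val C = set0.

Definition monochromatic (V : finType) (chi : coloring V) (x y z : V)
    (neq_xy : x != y) (neq_xz : x != z) (neq_yz : y != z) : Prop :=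
  chi (edge_of neq_xy) = chi (edge_of neq_xz) /\
  chi (edge_of neq_xz) = chi (edge_of neq_yz).

(* Main.v *)
Require Import Defs.
From mathcomp Require Import all_boot zify.

Set Implicit Arguments.
Unset Strict Implicit.
Unset Printing Implicit Defensive.

(* Fix a k-set X with complement Y and colour a k-set A by f(A), the colour of
   the edge XA.  If A, B, C are distinct from X and from each other, have the
   same f-colour, are pairwise disjoint inside X and have no common point, then
   one of XAB, XAC, XBC, ABC is the required triangle.

   Such A, B, C are found by swapping.  If P, Q are (k+1)-sets meeting X, disjoint
   inside X, and covering Y, then the points of X in neither together with the
   points of Y not in both form a k-set C, and A, B may be any k-subsets of P, Q.
   Hence we are done if P and Q both contain k-subsets of both colours.
   Otherwise, once P is fixed, two k-sets lying between Y \ P and the complement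
   of X :&: P that differ by a swap have the same colour, so all k-sets of this
   interval have the same colour, and Q = Y - y + x works. *)

(** * Four k-sets all of whose triples have empty intersection *)

Definition cone (T : finType) (k : nat) (X A B C : {set T}) : Prop :=
  [/\ [/\ #|A| = k, #|B| = k & #|C| = k], uniq [:: X; A; B; C],
      [/\ X :&: A :&: B = set0, X :&: A :&: C = set0 & X :&: B :&: C = set0]
    & A :&: B :&: C = set0].

(** The largest set that meets neither [P :&: Q] nor the traces of [P] and [Q] on [X], so its
    disjointness conditions in [cone] hold for all [A] in [P] and [B] in [Q] at once. *)
Definition third (T : finType) (X P Q : {set T}) : {set T} :=
  ~: ((P :&: Q) :|: (X :&: (P :|: Q))).

(** The union of [P] and [Q] covers the k + 1 points of [~: X], so inclusion-exclusion gives the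
    removed set, a disjoint union, the size (2k + 2) - (k + 1) = k + 1. *)
Lemma card_third (T : finType) (k : nat) (X P Q : {set T}) :
    #|T| = 2 * k + 1 -> #|X| = k -> #|P| = k.+1 -> #|Q| = k.+1 ->
    P :&: Q :&: X = set0 -> ~: X \subset P :|: Q ->
  #|third X P Q| = k.
Proof.
move=> cT cX cP cQ PQX YPQ.
have e1 := cardsUI P Q.
have e2 := cardsID X (P :|: Q).
have e3 : (P :|: Q) :\: X = ~: X.
  by rewrite setDE; apply/setIidPr.
have e4 := cardsUI (P :&: Q) (X :&: (P :|: Q)).
have e5 : P :&: Q :&: (X :&: (P :|: Q)) = set0.
  by rewrite setIA PQX set0I.
have e6 := cardsC X.
have e7 := cardsC (P :&: Q :|: X :&: (P :|: Q)).
move: e1 e2 e4 e6 e7; rewrite e3 e5 cards0 (setIC _ X) /third; lia.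
Qed.

(** Disjointness is built into [third]; the work is distinctness, which is witnessed by a point [p]
    of [P] and a point [q] of [Q], both in [X]. *)
Lemma cone_third (T : finType) (k : nat) (X P Q A B : {set T}) :
    #|T| = 2 * k + 1 -> #|X| = k -> #|P| = k.+1 -> #|Q| = k.+1 ->
    P :&: X != set0 -> Q :&: X != set0 ->
    P :&: Q :&: X = set0 -> ~: X \subset P :|: Q ->
    A \subset P -> B \subset Q -> #|A| = k -> #|B| = k ->
  cone k X A B (third X P Q).
Proof.
move=> cT cX cP cQ PX QX PQX YPQ AP BQ cA cB.
have cC := card_third cT cX cP cQ PQX YPQ.
have [p /setIP[pP pX]] := set0Pn _ PX.
have [q /setIP[qQ qX]] := set0Pn _ QX.
have noPQX z : z \in P -> z \in Q -> z \in X -> False.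
  by move=> zP zQ zX; have := in_set0 z; rewrite -PQX !inE zP zQ zX.
have sAP z : z \in A -> z \in P by apply/subsetP.
have sBQ z : z \in B -> z \in Q by apply/subsetP.
(* Disjoint sets of sizes k and k + 1 partition the 2k + 1 points. If [A] is the third set, it
   misses [Q], so it is the complement of [Q] and contains [p], which the third set excludes;
   likewise for [B], [P] and [q]. *)
have compl (D E : {set T}) : #|D| = k -> #|E| = k.+1 -> D :&: E = set0 ->
    forall z, z \notin E -> z \in D.
  move=> cD cE DE z zE; have sub : D \subset ~: E.
    by rewrite subsets_disjoint setCK -setI_eq0 DE.
  have /eqP-> : D == ~: E by rewrite eqEcard sub; have := cardsC E; lia.
  by rewrite inE.
split=> //.
- rewrite /= !inE !negb_or !andbT; apply/and3P; split.
  + apply/and3P; split; apply/eqP=> e.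
    * by apply: (noPQX q) => //; apply: sAP; rewrite -e.
    * by apply: (noPQX p) => //; apply: sBQ; rewrite -e.
    * have : p \notin third X P Q by rewrite !inE pP pX /= orbT.
      by rewrite -e pX.
  + apply/andP; split; apply/eqP=> e.
    (* If [A = B], both lie in [P :&: Q]. Together with [p] and [q] this intersection fits into the
       complement of the third set, of size k + 1, so it has at most k - 1 points. *)
    * have sub : A \subset (P :&: Q) by rewrite subsetI AP e.
      have := subset_leq_card sub; rewrite cA.
      have e1 := cardsUI (P :&: Q) [set p; q].
      have e2 : P :&: Q :&: [set p; q] = set0.
        apply/setP=> z; rewrite !inE; apply/negP => /andP[/andP[zP zQ]].
        by case/orP => /eqP ez; apply: (noPQX z); rewrite // ez.
      have pq : p != q by apply/eqP => ez; apply: (noPQX p); rewrite // ez.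
      have e3 := cardsC (P :&: Q :|: X :&: (P :|: Q)).
      have sub2 : P :&: Q :|: [set p; q] \subset P :&: Q :|: X :&: (P :|: Q).
        apply/subsetP=> z; rewrite !inE => /orP[->//|].
        by case/orP => /eqP->; rewrite ?pX ?pP ?qX ?qQ ?orbT.
      have := subset_leq_card sub2.
      move: e1 e3 cC; rewrite e2 cards0 cards2 pq /third; lia.
    * have AQ : A :&: Q = set0.
        apply/setP=> z; rewrite in_set0 in_setI; apply/negP=> /andP[zA zQ].
        by have zP := sAP _ zA; move: zA; rewrite e !inE zP zQ.
      have pA : p \in A by apply: (compl A Q) => //; apply/negP => /noPQX; apply.
      by move: pA; rewrite e !inE pX pP orbT.
  + apply/eqP=> e.
    have BP : B :&: P = set0.
      apply/setP=> z; rewrite in_set0 in_setI; apply/negP=> /andP[zB zP].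
      by have zQ := sBQ _ zB; move: zB; rewrite e !inE zP zQ.
    have qB : q \in B.
      by apply: (compl B P) => //; apply/negP => qP; apply: (noPQX q).
    by move: qB; rewrite e !inE qX qQ !orbT.
- split; apply/setP=> z; rewrite !inE; apply/negP.
  + by case/andP=> /andP[zX /sAP zP] /sBQ zQ; apply: (noPQX z).
  + by case/andP=> /andP[zX /sAP zP]; rewrite zX zP orbT.
  + by case/andP=> /andP[zX /sBQ zQ]; rewrite zX zQ !orbT.
- apply/setP=> z; rewrite !inE; apply/negP.
  by case/andP=> /andP[/sAP zP /sBQ zQ]; rewrite zP zQ.
Qed.

(** * Unicoloured sets, and colours along swaps *)

Definition unicolored (T : finType) (k : nat) (f : {set T} -> bool) (P : {set T}) :=
  [forall A : {set T}, forall B : {set T},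
     [&& A \subset P, B \subset P, #|A| == k & #|B| == k] ==> (f A == f B)].

Lemma unicoloredP (T : finType) (k : nat) (f : {set T} -> bool) (P A B : {set T}) :
  unicolored k f P -> A \subset P -> B \subset P -> #|A| = k -> #|B| = k -> f A = f B.
Proof.
move=> /forallP/(_ A)/forallP/(_ B)/implyP H AP BP cA cB.
by apply/eqP/H; rewrite AP BP cA cB eqxx.
Qed.

Lemma not_unicolored (T : finType) (k : nat) (f : {set T} -> bool) (P : {set T}) b :
  ~~ unicolored k f P -> exists A : {set T}, [/\ A \subset P, #|A| = k & f A = b].
Proof.
move=> /forallPn[A] /forallPn[B]; rewrite negb_imply.
case/andP=> /and4P[AP BP /eqP cA /eqP cB] fAB.
have [e | e] := eqVneq (f A) b; first by exists A.
by exists B; split=> //; case: (f A) (f B) b fAB e => [] [] [].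
Qed.

Lemma card_swap (T : finType) (A : {set T}) a b :
  a \in A -> b \notin A -> #|b |: A :\ a| = #|A|.
Proof.
by move=> aA bA; rewrite cardsU1 (cardsD1 a A) aA !inE (negbTE bA) andbF.
Qed.

(** Swaps lead from [A] to [B] inside the interval, by induction on the size of [A :\: B]. A swap
    bringing in [b] takes place inside the (k+1)-set [b |: A], so it keeps the colour if that set
    meets [X]; a point of [X :&: U] serves as a detour otherwise. *)
Lemma interval_constant (T : finType) (k : nat) (f : {set T} -> bool)
    (X L U : {set T}) :
    X :&: U != set0 ->
    (forall P : {set T}, #|P| = k.+1 -> L \subset P -> P \subset U ->
       P :&: X != set0 -> unicolored k f P) ->
  forall A B : {set T}, #|A| = k -> #|B| = k -> L \subset A -> A \subset U ->
    L \subset B -> B \subset U -> f A = f B.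
Proof.
move=> XU uni.
have step (A : {set T}) a b : #|A| = k -> L \subset A -> A \subset U -> L \subset (A :\ a) ->
    a \in A -> b \notin A -> b \in U -> (b |: A) :&: X != set0 ->
    f A = f (b |: A :\ a).
  move=> cA LA AU LAa aA bA bU bAX.
  apply: (@unicoloredP _ k f (b |: A)).
  - apply: uni => //; first by rewrite cardsU1 bA cA.
      by apply: subset_trans LA _; apply: subsetU1.
    by rewrite subUset sub1set bU.
  - exact: subsetU1.
  - by rewrite setUS ?subD1set.
  - by [].
  - by rewrite card_swap.
move=> A B; move: {2}_.+1 (ltnSn #|A :\: B|) => m.
elim: m A => // m IH A; rewrite ltnS => mAB cA cB LA AU LB BU.
have [-> // | neAB] := eqVneq A B.
have [a /setDP[aA aB]] : exists a, a \in A :\: B.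
  apply/set0Pn; apply: contra neAB; rewrite setD_eq0 => sAB.
  by rewrite eqEcard sAB cA cB leqnn.
have [b /setDP[bB bA]] : exists b, b \in B :\: A.
  apply/set0Pn; apply: contra neAB; rewrite setD_eq0 => sBA.
  by rewrite eq_sym eqEcard sBA cA cB leqnn.
have bU := subsetP BU _ bB.
have LAa : L \subset A :\ a.
  apply/subsetP=> z zL; rewrite !inE (subsetP LA) // andbT.
  by apply: contraNneq aB => <-; apply: (subsetP LB).
set A1 := b |: A :\ a.
have LA1 : L \subset A1 by apply: subset_trans LAa _; apply: subsetU1.
have A1U : A1 \subset U.
  by rewrite subUset sub1set bU (subset_trans _ AU) ?subD1set.
have cA1 : #|A1| = k by rewrite card_swap.
transitivity (f A1).
  have [bAX | bAX] := eqVneq ((b |: A) :&: X) set0; last exact: step.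
  (* The swap of [a] for [b] is replaced by [a] for [x] followed by [x] for [b]. *)
  have noX z : z \in X -> z \notin b |: A.
    by move=> zX; apply/negP=> zbA; have := in_set0 z; rewrite -bAX inE zbA zX.
  have [x /setIP[xX xU]] := set0Pn _ XU.
  have := noX x xX; rewrite !inE negb_or => /andP[xb xA].
  have -> : f A = f (x |: A :\ a).
    by apply: step => //; apply/set0Pn; exists x; rewrite !inE eqxx xX.
  have -> : x |: A :\ a = x |: A1 :\ b.
    apply/setP=> z; rewrite !inE; case: eqP => //= _.
    by case: (eqVneq z b) => //= ->; rewrite (negbTE bA) andbF.
  symmetry; apply: step => //.
  - apply/subsetP=> z zL; rewrite !inE -in_setD1 (subsetP LAa) // orbT andbT.
    by apply: contraNneq bA => <-; apply: (subsetP LA).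
  - by rewrite !inE eqxx.
  - by rewrite !inE negb_or xb (negbTE xA) andbF.
  - by apply/set0Pn; exists x; rewrite !inE eqxx xX.
apply: IH => //; apply: leq_trans mAB; apply: proper_card.
apply/properP; split.
  apply/subsetP=> z; rewrite !inE => /andP[zB /orP[/eqP e|/andP[_ ->]]].
    by rewrite e bB in zB.
  by rewrite zB.
by exists a; rewrite !inE ?aB ?aA // eqxx /= orbF; apply: contraNneq bA => <-.
Qed.

(** With [x] in [X :\: P] and [y] in [P :\: X], take Q = Y - y + x, where Y is [~: X]. Both Y - y
    and the third set of [P] and Q lie in the interval, so they get the colour of [A]. *)
Lemma cone_of_constant_interval (T : finType) (k : nat) (f : {set T} -> bool)
    (X P A : {set T}) :
    #|T| = 2 * k + 1 -> #|X| = k -> #|P| = k.+1 ->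
    P :&: X != set0 -> X :\: P != set0 -> A \subset P -> #|A| = k ->
    (forall B : {set T}, #|B| = k -> ~: X :\: P \subset B ->
       B \subset ~: (X :&: P) -> f B = f A) ->
  exists B C : {set T}, cone k X A B C /\ f A = f B /\ f A = f C.
Proof.
move=> cT cX cP PX XP AP cA const.
have [x /setDP[xX xP]] := set0Pn _ XP.
have [y /setDP[yP yX]] : exists y, y \in P :\: X.
  apply/set0Pn; rewrite setD_eq0; apply/negP=> /subset_leq_card; lia.
have cY : #|~: X :\ y| = k.
  by have := cardsC X; rewrite (cardsD1 y (~: X)) inE yX; lia.
have xY : x \notin ~: X :\ y by rewrite !inE xX andbF.
have cQ : #|x |: ~: X :\ y| = k.+1 by rewrite cardsU1 xY cY.
have PQX : P :&: (x |: ~: X :\ y) :&: X = set0.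
  apply/setP=> z; rewrite !inE; apply/negP=> /andP[/andP[zP]].
  case/orP=> [/eqP e|/andP[_ /negbTE->]//].
  by rewrite -e zP in xP.
have YPQ : ~: X \subset P :|: (x |: ~: X :\ y).
  apply/subsetP=> z; rewrite !inE => ->; rewrite andbT.
  by case: (eqVneq z y) => [->|_]; rewrite ?yP ?orbT.
exists (~: X :\ y), (third X P (x |: ~: X :\ y)); split; last split.
- apply: cone_third => //; last exact: subsetU1.
  by apply/set0Pn; exists x; rewrite !inE eqxx xX.
- symmetry; apply: const => //; apply/subsetP=> z; rewrite !inE.
    by case/andP=> zP ->; rewrite andbT; apply: contraNneq zP => ->.
  by case/andP=> _ /negbTE->.
- symmetry; apply: const; first exact: card_third.
    by apply/subsetP=> z; rewrite !inE => /andP[/negbTE-> /negbTE->].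
  by apply/subsetP=> z; rewrite !inE; case: (z \in X); case: (z \in P); rewrite ?orbT.
Qed.

(** * Monochromatic cones and triangles *)

Lemma monochromatic_cone (T : finType) (k : nat) (f : {set T} -> bool) (X : {set T}) :
    2 <= k -> #|T| = 2 * k + 1 -> #|X| = k ->
  exists A B C : {set T}, cone k X A B C /\ f A = f B /\ f A = f C.
Proof.
move=> k2 cT cX.
pose adm (P : {set T}) :=
  [&& #|P| == k.+1, P :&: X != set0, X :\: P != set0 & ~~ unicolored k f P].
have [P /and4P[/eqP cP PX XP bic] | noP] := pickP adm.
- pose good (Q : {set T}) := [&& #|Q| == k.+1, ~: X :\: P \subset Q,
    Q \subset ~: (X :&: P), Q :&: X != set0 & ~~ unicolored k f Q].
  have [Q /and5P[/eqP cQ LQ QU QX bicQ] | noQ] := pickP good.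
    (* The third set depends only on [P] and [Q], so its colour can be fixed before [A] and [B] are
       chosen to match it. *)
    pose b := f (third X P Q).
    have [A [AP cA fA]] := not_unicolored b bic.
    have [B [BQ cB fB]] := not_unicolored b bicQ.
    exists A, B, (third X P Q); rewrite fA fB; split=> //.
    apply: cone_third => //.
      apply/setP=> z; rewrite !inE; apply/negP=> /andP[/andP[zP zQ] zX].
      by have := subsetP QU z zQ; rewrite !inE zP zX.
    apply/subsetP=> z zX; rewrite inE; case: (boolP (z \in P)) => //= zP.
    by apply: (subsetP LQ); rewrite inE zP zX.
  have XU : X :&: ~: (X :&: P) != set0.
    have [x /setDP[xX xP]] := set0Pn _ XP.
    by apply/set0Pn; exists x; rewrite !inE xX (negbTE xP).
  have const : forall A B : {set T}, #|A| = k -> #|B| = k ->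
      ~: X :\: P \subset A -> A \subset ~: (X :&: P) ->
      ~: X :\: P \subset B -> B \subset ~: (X :&: P) -> f A = f B.
    apply: (interval_constant XU) => Q cQ LQ QU QX; apply/negPn/negP=> bicQ.
    by have := noQ Q; rewrite /good cQ eqxx LQ QU QX bicQ.
  (* No member of the interval has to be exhibited: [b] is [true] if some member has that colour,
     and [false] otherwise. *)
  have [b fb] : exists b, forall B : {set T}, #|B| = k -> ~: X :\: P \subset B ->
      B \subset ~: (X :&: P) -> f B = b.
    have [B0 /and4P[/eqP c0 L0 U0 f0] | no0] := pickP (fun B : {set T} =>
        [&& #|B| == k, ~: X :\: P \subset B, B \subset ~: (X :&: P) & f B]).
      by exists true => B cB LB BU; rewrite -f0; apply: const.
    by exists false => B cB LB BU; have := no0 B; rewrite cB eqxx LB BU.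
  have [A [AP cA fA]] := not_unicolored b bic.
  have [|B [C H]] := cone_of_constant_interval (f := f) cT cX cP PX XP AP cA.
    by rewrite fA.
  by exists A, B, C.
(* No set is bicoloured: any [P] whose trace on [X] is a point [x0] will do. *)
have uni (P : {set T}) : #|P| = k.+1 -> P :&: X != set0 -> X :\: P != set0 -> unicolored k f P.
  move=> cP PX XP; apply/negPn/negP=> bic.
  by have := noP P; rewrite /adm cP eqxx PX XP bic.
have cY : #|~: X| = k.+1 by have := cardsC X; lia.
have [x0 [x1 [x0X x1X x10]]] : exists x0 x1, [/\ x0 \in X, x1 \in X & x1 != x0].
  have /card_gt1P[x0 [x1 [? ? ?]]] : 1 < #|X| by rewrite cX.
  by exists x1, x0.
have [y [z [yX zX zy]]] : exists y z, [/\ y \notin X, z \notin X & z != y].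
  have /card_gt1P[z [y [zX yX ?]]] : 1 < #|~: X| by rewrite cY; lia.
  by rewrite !inE in zX yX; exists y, z.
pose P w := x0 |: ~: X :\ w.
have cYw w : w \notin X -> #|~: X :\ w| = k.
  by move=> wX; have := cardsD1 w (~: X); rewrite cY inE wX; lia.
have cP w : w \notin X -> #|P w| = k.+1.
  by move=> wX; rewrite cardsU1 !inE x0X andbF cYw.
have PX w : P w :&: X != set0.
  by apply/set0Pn; exists x0; rewrite !inE eqxx x0X.
have XP w : X :\: P w != set0.
  by apply/set0Pn; exists x1; rewrite !inE x1X (negbTE x10) andbF.
(* This set lies in [P z] as well as in [P y]. Since [P z] is unicoloured and contains [~: X :\ z],
   a member of the interval of [P y], the colour of [A] is that of the interval. *)
pose A := P y :\ z.
have cA : #|A| = k.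
  by have := cardsD1 z (P y); rewrite cP // !inE zy zX orbT; rewrite -/A; lia.
have AP : A \subset P y by apply: subD1set.
have fA : f A = f (~: X :\ z).
  apply: (unicoloredP (uni _ (cP z zX) (PX z) (XP z))); rewrite ?cYw //.
    apply/subsetP=> w; rewrite !inE => /andP[wz /orP[->//|/andP[_ ->]]].
    by rewrite wz orbT.
  exact: subsetU1.
have XU : X :&: ~: (X :&: P y) != set0.
  by apply/set0Pn; exists x1; rewrite !inE x1X (negbTE x10) andbF.
have inP w : (w \in X) && (w \in P y) = (w == x0).
  rewrite !inE; case: eqVneq => [->|_] /=; first by rewrite x0X.
  by case: (w \in X); rewrite ?andbF.
have [|B [C H]] :=
    cone_of_constant_interval (f := f) cT cX (cP y yX) (PX y) (XP y) AP cA.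
  move=> B cB LB BU; rewrite fA.
  apply: (@interval_constant _ k f X (~: X :\: P y) _ XU); rewrite ?cYw //.
  (* Sets in the interval avoid [x0], hence do not contain [X], as [uni] requires. *)
  - move=> Q cQ _ QU QX; apply: uni => //; apply/set0Pn; exists x0.
    rewrite inE x0X andbT; apply/negP=> /(subsetP QU).
    by rewrite inE in_setI inP eqxx.
  - apply/subsetP=> w; rewrite !inE => /andP[]; rewrite negb_or negb_and negbK.
    case/andP=> _ /orP[/eqP-> wX|/negbTE->//]; by rewrite eq_sym zy.
  - apply/subsetP=> w; rewrite !inE => /andP[_ /negbTE->]; by [].
by exists A, B, C.
Qed.

(** If an edge among [A], [B], [C] has the common colour of the edges from [X], it closes a triangle
    with [X]; otherwise all three edges have the other colour. *)
Lemma nonintersecting_triangle (T : finType) (k : nat)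
    (c : {set T} -> {set T} -> bool) :
    2 <= k -> #|T| = 2 * k + 1 -> (forall A B, c A B = c B A) ->
  exists A B C : {set T},
    [/\ #|A| = k, #|B| = k & #|C| = k] /\ uniq [:: A; B; C] /\
    A :&: B :&: C = set0 /\ c A B = c A C /\ c A C = c B C.
Proof.
move=> k2 cT csym.
have [X cX] : exists X : {set T}, #|X| = k.
  have : 0 < #|[set X : {set T} | #|X| == k]|.
    by rewrite card_draws cT bin_gt0; lia.
  by case/card_gt0P=> X; rewrite inE => /eqP; exists X.
have [A [B [C [[[cA cB cC] uABC [XAB XAC XBC] ABC] [fB fC]]]]] :=
  monochromatic_cone (c X) k2 cT cX.
move: (uABC); rewrite /= !inE !negb_or !andbT.
case/andP=> /and3P[XA XB XC] /andP[/andP[AB AC] BC].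
have [e | nAB] := eqVneq (c A B) (c X A).
  exists X, A, B; rewrite /= !inE negb_or XA XB AB e -fB; do !split => //.
have [e | nAC] := eqVneq (c A C) (c X A).
  exists X, A, C; rewrite /= !inE negb_or XA XC AC e -fC; do !split => //.
have [e | nBC] := eqVneq (c B C) (c X A).
  exists X, B, C; rewrite /= !inE negb_or XB XC BC e -fB -fC; do !split => //.
exists A, B, C; rewrite /= !inE negb_or AB AC BC; do !split => //.
  by case: (c A B) (c A C) (c X A) nAB nAC => [] [] [].
by case: (c A C) (c B C) (c X A) nAC nBC => [] [] [].
Qed.

Theorem theorem1p3 (k : nat) (hk : 2 <= k)
    (chi : coloring (ksubset (2 * k + 1) k)) :
  exists (A B C : ksubset (2 * k + 1) k)
         (hAB : A != B) (hAC : A != C) (hBC : B != C),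
    nonintersecting A B C /\ monochromatic chi hAB hAC hBC.
Proof.
(* To colour arbitrary pairs of sets, [c] forms the set of vertices equal to [A] or [B]. It is an
   edge exactly when [A] and [B] are distinct k-sets; in all other cases [insub] returns [None] and
   the colour defaults to [false]. The unordered form makes [c] symmetric. *)
pose red (o : option (edge (ksubset (2 * k + 1) k))) :=
  if o is Some e then if chi e is Red then true else false else false.
pose c (A B : {set 'I_(2 * k + 1)}) :=
  red (insub [set u : ksubset (2 * k + 1) k | (val u == A) || (val u == B)]).
have csym A B : c A B = c B A.
  by congr (red (insub _)); apply/setP=> u; rewrite !inE orbC.
have cE (A B : ksubset (2 * k + 1) k) (h : A != B) :
    c (val A) (val B) = red (Some (edge_of h)).
  congr red; have -> : [set u : ksubset (2 * k + 1) k |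
      (val u == val A) || (val u == val B)] = val (edge_of h).
    by apply/setP=> u; rewrite !inE.
  exact: valK.
have redI e e' : red (Some e) = red (Some e') -> chi e = chi e'.
  by rewrite /red; case: (chi e) (chi e') => [] [].
have [A [B [C [[/eqP cA /eqP cB /eqP cC] [u [ABC [e1 e2]]]]]]] :=
  nonintersecting_triangle hk (card_ord _) csym.
move: u; rewrite /= !inE negb_or andbT => /andP[/andP[AB AC] BC].
pose S (D : {set 'I_(2 * k + 1)}) (cD : #|D| == k) : ksubset (2 * k + 1) k :=
  exist _ D cD.
have hAB : S A cA != S B cB by rewrite -val_eqE.
have hAC : S A cA != S C cC by rewrite -val_eqE.
have hBC : S B cB != S C cC by rewrite -val_eqE.
exists (S A cA), (S B cB), (S C cC), hAB, hAC, hBC; split; first exact: ABC.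
by split; apply: redI; rewrite -!cE.
Qed.
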